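(* Let $d\ge2$ be a nonsquare integer, let $(X_n,Y_n)$, $n\ge0$, be the nonnegative solutions of $x^2-dy^2=1$, and let $n\ge1$. The following straight-line program, with inputs $X_1,Y_1,n$, uses $21$ operations and returns $(X_n,Y_n)$: $$h_b=X_1+1,\quad p_b=X_1h_b,\quad r_b=2p_b,\quad b=r_b\mathbin{\dot{-}}1,$$ $$\Lambda=b^n,\quad \Lambda_2=\Lambda\Lambda,\quad \ell_n=nn+n,\quad \Phi=b^{\ell_n},\quad \Psi=\Phi\Lambda,$$ $$\Omega=X_1\Lambda,\quad \Xi=(\Lambda_2\mathbin{\dot{-}}2\Omega)+1,$$ $$X_n=\lfloor(\Psi\mathbin{\dot{-}}X_1\Phi)/\Xi\rfloor\bmod\Lambda,\qquad Y_n=\lfloor Y_1\Phi/\Xi\rfloor\bmod\Lambda.$$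
   Context: The fundamental solution $(X_1,Y_1)$ is the solution of $x^2-dy^2=1$ in positive integers with $X_1$ least, and $X_n+Y_n\sqrt d=(X_1+Y_1\sqrt d)^n$ for $n\ge0$. All values are in $\mathbb N=\{0,1,2,\dots\}$. A straight-line program is a finite sequence of assignments using the six operations $u+v$, $u\mathbin{\dot{-}}v=\max(u-v,0)$, $uv$, $\lfloor u/v\rfloor$, $u^v$, $u\bmod v$ (with positive divisors). Each application of one of these operations counts as one operation; constants, assignments, and reuse of previously computed values are free. *)

(* Defs.v *)
From Stdlib Require Import Reals ZArith Arith List String.
Import ListNotations.

Definition pell_solution (d x y : nat) : Prop :=
  (Z.of_nat x ^ 2 - Z.of_nat d * Z.of_nat y ^ 2 = 1)%Z.

Definition fundamental_solution (d x y : nat) : Prop :=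
  0 < x /\ 0 < y /\ pell_solution d x y /\
  forall x' y', 0 < x' -> 0 < y' -> pell_solution d x' y' -> x <= x'.

(* For nonsquare [d] the identity in R determines both coordinates; at [n = 0]
   it gives the trivial solution (1, 0). *)
Definition pell_sequence (d : nat) (X Y : nat -> nat) : Prop :=
  fundamental_solution d (X 1) (Y 1) /\
  forall n : nat,
    (INR (X n) + INR (Y n) * sqrt (INR d) =
     (INR (X 1%nat) + INR (Y 1%nat) * sqrt (INR d)) ^ n)%R.

Inductive op := Add | Monus | Mul | Div | Pow | Mod.

(* The result is [None] when the divisor is zero. *)
Definition apply_op (o : op) (u v : nat) : option nat :=
  match o with
  | Add => Some (u + v)
  | Monus => Some (u - v)
  | Mul => Some (u * v)
  | Div => if v =? 0 then None else Some (u / v)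
  | Pow => Some (u ^ v)
  | Mod => if v =? 0 then None else Some (u mod v)
  end.

Inductive expr :=
  | Const (c : nat)
  | Var (x : string)
  | Op (o : op) (e1 e2 : expr).

Record program := Program {
  inputs : list string;
  body : list (string * expr);
  outputs : list string }.

Fixpoint expr_cost (e : expr) : nat :=
  match e with
  | Const _ | Var _ => 0
  | Op _ e1 e2 => S (expr_cost e1 + expr_cost e2)
  end.

Definition cost (p : program) : nat :=
  list_sum (map (fun a => expr_cost (snd a)) (body p)).

Definition store := list (string * nat).

Fixpoint lookup (s : store) (x : string) : option nat :=
  match s with
  | [] => None
  | (y, v) :: s' => if String.eqb x y then Some v else lookup s' x
  end.

Fixpoint eval (s : store) (e : expr) : option nat :=
  match e with
  | Const c => Some c
  | Var x => lookup s x
  | Op o e1 e2 =>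
      match eval s e1, eval s e2 with
      | Some u, Some v => apply_op o u v
      | _, _ => None
      end
  end.

Fixpoint exec (s : store) (l : list (string * expr)) : option store :=
  match l with
  | [] => Some s
  | (x, e) :: l' =>
      match eval s e with
      | Some v => exec ((x, v) :: s) l'
      | None => None
      end
  end.

Fixpoint read (s : store) (xs : list string) : option (list nat) :=
  match xs with
  | [] => Some []
  | x :: xs' =>
      match lookup s x, read s xs' with
      | Some v, Some vs => Some (v :: vs)
      | _, _ => None
      end
  end.

(* [None] if a divisor is zero or an undefined variable is read. *)
Definition run (p : program) (args : list nat) : option (list nat) :=
  match exec (combine (inputs p) args) (body p) with
  | Some s => read s (outputs p)
  | None => None
  end.

Declare Scope slp_scope.
Delimit Scope slp_scope with slp.
Bind Scope slp_scope with expr.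
Local Coercion Const : nat >-> expr.
Local Coercion Var : string >-> expr.
Local Notation "u + v" := (Op Add u v) : slp_scope.
Local Notation "u - v" := (Op Monus u v) : slp_scope.
Local Notation "u * v" := (Op Mul u v) : slp_scope.
Local Notation "u / v" := (Op Div u v) : slp_scope.
Local Notation "u ^ v" := (Op Pow u v) : slp_scope.
Local Notation "u 'mod' v" := (Op Mod u v) : slp_scope.
Local Notation "x <- e" := (@pair string expr x%string e%slp)
  (at level 75, no associativity).
Local Open Scope string_scope.
Local Open Scope nat_scope.

Definition pell_program : program := {|
  inputs := ["X_1"; "Y_1"; "n"];
  body := [
    "h_b" <- "X_1" + 1;
    "p_b" <- "X_1" * "h_b";
    "r_b" <- 2 * "p_b";
    "b" <- "r_b" - 1;
    "Lambda" <- "b" ^ "n";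
    "Lambda_2" <- "Lambda" * "Lambda";
    "l_n" <- "n" * "n" + "n";
    "Phi" <- "b" ^ "l_n";
    "Psi" <- "Phi" * "Lambda";
    "Omega" <- "X_1" * "Lambda";
    "Xi" <- ("Lambda_2" - 2 * "Omega") + 1;
    "X_n" <- (("Psi" - "X_1" * "Phi") / "Xi") mod "Lambda";
    "Y_n" <- (("Y_1" * "Phi") / "Xi") mod "Lambda"
  ];
  outputs := ["X_n"; "Y_n"]
|}.

(* Main.v *)
Require Import Defs.
From Stdlib Require Import Arith List.
From Stdlib Require Import ZArith Reals Lia Lra.
Import ListNotations.

(** Put [a = X 1].  Both coordinates satisfy [u (k+2) = 2a * u (k+1) - u k], so
    their generating functions are rational with denominator [1 - 2at + t^2].
    Evaluated at [t = 1/L] and multiplied by [L^n], such a generating function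
    is [N * L^n / Xi] with [Xi = L^2 - 2aL + 1], and it equals
    [u 0 * L^n + ... + u n] plus the tail [u (n+1) / L + u (n+2) / L^2 + ...].
    If [L] is so large that the tail is below 1 and [u n] is a single digit in
    base [L], the floor of the quotient removes the tail and reduction
    modulo [L] extracts [u n].

    The tail is [(u (n+1) * L - u n) / Xi] exactly ([recurrence_division]),
    hence below 1 as soon as [u (n+1) + 2a <= L] ([recurrence_digit]).  The base
    [L = b^n] with [b = 2a(a+1) - 1] meets this for both coordinates: [b] is
    chosen so that [X 2 + 2a = b], which is the bound for [n = 1], and each
    further index multiplies [X] by at most [2a <= b] ([pell_base_bound]).
    Since [Y n <= X n], the same base serves for [Y].

    The recurrences come from the real identity defining the sequence, because
    [sqrt d] is irrational ([sqrt_coordinates_unique]). *)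

(** * Irrationality of the square root *)

(** In lowest terms [p / q], Gauss's lemma makes [q] divide [p], hence [q = 1]
    and [d] would be a square. *)
Lemma nonsquare_square_ratio (d p q : nat) :
  (forall m, d <> m * m) -> p * p = d * (q * q) -> q = 0.
Proof.
  intros hsq e.
  destruct (Nat.eq_dec q 0) as [|hq]; [assumption|exfalso].
  assert (hg : Nat.gcd p q <> 0) by (rewrite Nat.gcd_eq_0; tauto).
  assert (hcop := Nat.gcd_div_gcd p q _ hg eq_refl).
  destruct (Nat.gcd_divide_l p q) as [p' hp].
  destruct (Nat.gcd_divide_r p q) as [q' hq'].
  set (g := Nat.gcd p q) in *; clearbody g.
  rewrite hp, hq', !Nat.div_mul in hcop by assumption.
  assert (e' : p' * p' = d * (q' * q')).
  { apply (Nat.mul_cancel_l _ _ (g * g)); [nia|]. subst p q. nia. }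
  assert (hdiv : Nat.divide q' p').
  { apply Nat.gauss with p'.
    - exists (d * q'). lia.
    - now rewrite Nat.gcd_comm. }
  assert (q1 : q' = 1).
  { apply Nat.divide_1_r. rewrite <- hcop.
    apply Nat.gcd_greatest; [assumption|apply Nat.divide_refl]. }
  apply (hsq p'). rewrite e', q1. lia.
Qed.

Lemma sqrt_coordinates_unique (d x y x' y' : nat) :
  (forall m, d <> m * m) ->
  (INR x + INR y * sqrt (INR d) = INR x' + INR y' * sqrt (INR d))%R ->
  x = x' /\ y = y'.
Proof.
  intros hsq e.
  assert (hs : (sqrt (INR d) * sqrt (INR d) = INR d)%R)
    by apply sqrt_sqrt, pos_INR.
  set (s := sqrt (INR d)) in *; clearbody s.
  assert (eR : ((INR x - INR x') * (INR x - INR x') =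
                INR d * ((INR y - INR y') * (INR y - INR y')))%R).
  { replace (INR x - INR x')%R with (- (INR y - INR y') * s)%R by lra.
    rewrite <- hs. ring. }
  rewrite !INR_IZR_INZ, <- !minus_IZR, <- !mult_IZR in eR.
  apply eq_IZR in eR.
  assert (eN : Z.abs_nat (Z.of_nat x - Z.of_nat x') *
               Z.abs_nat (Z.of_nat x - Z.of_nat x') =
               d * (Z.abs_nat (Z.of_nat y - Z.of_nat y') *
                    Z.abs_nat (Z.of_nat y - Z.of_nat y'))).
  { rewrite <- !Zabs2Nat.inj_mul, eR, Zabs2Nat.inj_mul.
    now rewrite Zabs2Nat.id. }
  apply nonsquare_square_ratio in eN; [|assumption].
  assert (hy : y = y') by lia.
  split; [|assumption].
  subst y'. apply INR_eq. lra.
Qed.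

(** * Recurrences of the Pell sequence *)

Section PellSequence.

Context (d : nat) (hsq : forall m : nat, d <> m * m).
Context (X Y : nat -> nat) (hXY : pell_sequence d X Y).

Lemma pell_zero : X 0 = 1 /\ Y 0 = 0.
Proof.
  destruct hXY as [_ h].
  apply (sqrt_coordinates_unique d); [assumption|].
  rewrite h. simpl. ring.
Qed.

Lemma pell_succ (n : nat) :
  X (S n) = X 1 * X n + d * Y 1 * Y n /\ Y (S n) = X 1 * Y n + Y 1 * X n.
Proof.
  destruct hXY as [_ h].
  apply (sqrt_coordinates_unique d); [assumption|].
  rewrite h, <- tech_pow_Rmult, <- h, !plus_INR, !mult_INR.
  rewrite <- (sqrt_sqrt (INR d)) at 3 by apply pos_INR.
  ring.
Qed.

Lemma pell_fundamental_norm : X 1 * X 1 = d * (Y 1 * Y 1) + 1.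
Proof.
  destruct hXY as [(_ & _ & h & _) _]. unfold pell_solution in h. lia.
Qed.

Lemma pell_fundamental_pos : 1 <= X 1.
Proof. destruct hXY as [(h & _) _]. exact h. Qed.

Lemma pell_norm (n : nat) : X n * X n = d * (Y n * Y n) + 1.
Proof.
  induction n as [|n IH].
  - destruct pell_zero as [-> ->]. lia.
  - destruct (pell_succ n) as [-> ->].
    assert (h1 := pell_fundamental_norm).
    (* Multiplicativity of the norm. *)
    assert (h : (X 1 * X 1) * (X n * X n) + d * (Y 1 * Y 1) * (d * (Y n * Y n))
      = d * (Y n * Y n) * (X 1 * X 1) + d * (Y 1 * Y 1) * (X n * X n) + 1)
      by (rewrite h1, IH; ring).
    lia.
Qed.

Lemma pell_Y_le_X (n : nat) : Y n <= X n.
Proof.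
  assert (h := pell_norm n).
  assert (hd : d <> 0) by apply (hsq 0).
  apply Nat.square_le_simpl_nonneg; nia.
Qed.

Lemma pell_recurrence (n : nat) :
  X (S (S n)) + X n = 2 * X 1 * X (S n) /\
  Y (S (S n)) + Y n = 2 * X 1 * Y (S n).
Proof.
  destruct (pell_succ (S n)) as [-> ->].
  destruct (pell_succ n) as [-> ->].
  assert (h := pell_fundamental_norm).
  assert (hx : X 1 * X 1 * X n = (d * (Y 1 * Y 1) + 1) * X n) by now rewrite h.
  assert (hy : X 1 * X 1 * Y n = (d * (Y 1 * Y 1) + 1) * Y n) by now rewrite h.
  split; lia.
Qed.

Lemma pell_monotone (n : nat) : X n <= X (S n) /\ Y n <= Y (S n).
Proof.
  destruct (pell_succ n) as [-> ->].
  assert (h := pell_fundamental_pos). split; nia.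
Qed.

(** The case [n = 1] is an equality, and the step uses
    [X (n+2) <= 2 * X 1 * X (n+1)] together with [2 * X 1 <= b]. *)
Lemma pell_base_bound (n : nat) :
  1 <= n ->
  X (S n) + 2 * X 1 <= (2 * (X 1 * (X 1 + 1)) - 1) ^ n.
Proof.
  intros hn. assert (ha := pell_fundamental_pos).
  induction n as [|[|n] IH]; [lia| |].
  - rewrite Nat.pow_1_r.
    destruct (pell_recurrence 0) as [h _].
    destruct pell_zero as [h0 _]. rewrite h0 in h. lia.
  - specialize (IH ltac:(lia)).
    destruct (pell_recurrence (S n)) as [h _].
    rewrite Nat.pow_succ_r'.
    set (b := 2 * (X 1 * (X 1 + 1)) - 1) in *.
    assert (hb : 2 * X 1 <= b) by (unfold b; nia).
    clearbody b.
    transitivity (2 * X 1 * b ^ S n); [|now apply Nat.mul_le_mono_r].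
    transitivity (2 * X 1 * (X (S (S n)) + 2 * X 1)); [|nia].
    nia.
Qed.

End PellSequence.

(** * Digit extraction from a generating function *)

(** The quotient is [u 0 * L^n + ... + u (n-1) * L + u n]; only its residue
    modulo [L] is needed, so the higher digits are kept as the unspecified
    multiple [L * q].  The term [u n] of the remainder stands on the left to
    avoid a subtraction. *)
Lemma recurrence_division (a L Xi N : nat) (u : nat -> nat) (n : nat) :
  (forall k, u (S (S k)) + u k = 2 * a * u (S k)) ->
  Xi + 2 * a * L = L * L + 1 ->
  N + 2 * a * u 0 * L = u 0 * (L * L) + u 1 * L ->
  exists q, N * L ^ n + u n = Xi * (L * q + u n) + u (S n) * L.
Proof.
  intros hu hXi hN.
  induction n as [|n [q IH]].
  - exists 0. rewrite Nat.pow_0_r.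
    assert (h : (Xi + 2 * a * L) * u 0 = (L * L + 1) * u 0) by now rewrite hXi.
    lia.
  - exists (L * q + u n). specialize (hu n). rewrite Nat.pow_succ_r'.
    assert (h1 : (Xi + 2 * a * L) * u (S n) = (L * L + 1) * u (S n))
      by now rewrite hXi.
    assert (h2 : (u (S (S n)) + u n) * L = 2 * a * u (S n) * L) by now rewrite hu.
    assert (h3 : L * (N * L ^ n + u n) = L * (Xi * (L * q + u n) + u (S n) * L))
      by now rewrite IH.
    lia.
Qed.

Lemma recurrence_digit (a L Xi N : nat) (u : nat -> nat) (n : nat) :
  (forall k, u (S (S k)) + u k = 2 * a * u (S k)) ->
  Xi + 2 * a * L = L * L + 1 ->
  N + 2 * a * u 0 * L = u 0 * (L * L) + u 1 * L ->
  1 <= a -> u n <= u (S n) -> u (S n) + 2 * a <= L ->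
  ((N * L ^ n) / Xi) mod L = u n.
Proof.
  intros hu hXi hN ha hmono hL.
  destruct (recurrence_division a L Xi N u n hu hXi hN) as [q hq].
  assert (hdiv : L * q + u n = N * L ^ n / Xi).
  { apply Nat.div_unique with (u (S n) * L - u n).
    - assert (h : (u (S n) + 2 * a) * L <= L * L) by now apply Nat.mul_le_mono_r.
      lia.
    - assert (h : u n <= u (S n) * L) by nia. lia. }
  rewrite <- hdiv.
  symmetry. apply Nat.mod_unique with q; lia.
Qed.

(** * The program *)

Lemma run_pell_program (a y n : nat) :
  let L := (2 * (a * (a + 1)) - 1) ^ n in
  let Phi := (2 * (a * (a + 1)) - 1) ^ (n * n + n) in
  let Xi := L * L - 2 * (a * L) + 1 in
  L <> 0 ->
  run pell_program [a; y; n] =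
  Some [((Phi * L - a * Phi) / Xi) mod L; ((y * Phi) / Xi) mod L].
Proof.
  intros L Phi Xi hL.
  assert (hL' : (L =? 0) = false) by now apply Nat.eqb_neq.
  assert (hXi : (Xi =? 0) = false) by (apply Nat.eqb_neq; unfold Xi; lia).
  subst Xi Phi L. unfold run.
  cbn -[Nat.add Nat.mul Nat.sub Nat.pow Nat.div Nat.modulo Nat.eqb].
  rewrite hXi, hL'.
  cbn -[Nat.add Nat.mul Nat.sub Nat.pow Nat.div Nat.modulo Nat.eqb].
  reflexivity.
Qed.

Theorem mainTheorem5
  (d : nat) (hd : 2 <= d) (hsq : forall m : nat, d <> m * m)
  (X Y : nat -> nat) (hXY : pell_sequence d X Y)
  (n : nat) (hn : 1 <= n) :
  cost pell_program = 21 /\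
  run pell_program [X 1; Y 1; n] = Some [X n; Y n].
Proof.
  split; [reflexivity|].
  assert (ha := pell_fundamental_pos d X Y hXY).
  assert (hbound := pell_base_bound d hsq X Y hXY n hn).
  assert (hle := pell_Y_le_X d hsq X Y hXY (S n)).
  destruct (pell_monotone d hsq X Y hXY n) as [hmX hmY].
  destruct (pell_zero d hsq X Y hXY) as [hX0 hY0].
  assert (hrec := pell_recurrence d hsq X Y hXY).
  rewrite run_pell_program by lia.
  rewrite Nat.pow_add_r, Nat.pow_mul_r.
  set (L := (2 * (X 1 * (X 1 + 1)) - 1) ^ n) in *. clearbody L.
  set (Xi := L * L - 2 * (X 1 * L) + 1).
  assert (hXi : Xi + 2 * X 1 * L = L * L + 1).
  { assert (2 * X 1 * L <= L * L) by (apply Nat.mul_le_mono_r; lia).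
    unfold Xi. lia. }
  clearbody Xi.
  assert (hXL : X 1 * L <= L * L) by (apply Nat.mul_le_mono_r; lia).
  (* The numerators of the two generating functions are [1 - at] and
     [Y 1 * t]; scaled by [L^2] they become [L^2 - aL] and [Y 1 * L]. *)
  replace (L ^ n * L * L - X 1 * (L ^ n * L)) with ((L * L - X 1 * L) * L ^ n)
    by (rewrite Nat.mul_sub_distr_r; f_equal; ring).
  replace (Y 1 * (L ^ n * L)) with (Y 1 * L * L ^ n) by ring.
  rewrite (recurrence_digit (X 1) L Xi (L * L - X 1 * L) X n),
    (recurrence_digit (X 1) L Xi (Y 1 * L) Y n);
    try assumption; try (intro k; apply hrec); try reflexivity;
    rewrite ?hX0, ?hY0; lia.
Qed.
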